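(* Let $r \le \min(M,N)$ be positive integers and let $\mathcal{P}=\mathcal{B}_1=\{\mathbf{x}\in\mathbb{R}^r \mid \|\mathbf{x}\|_1\le 1\}$. Let $\mathbf{H}_g\in\mathbb{R}^{M\times r}$ have full column rank, let $\mathbf{S}_g\in\mathbb{R}^{r\times N}$ have all of its columns in $\mathcal{P}$, and set $\mathbf{Y}=\mathbf{H}_g\mathbf{S}_g$. Suppose $\mathbf{S}_g$ is a sufficiently scattered factor corresponding to $\mathcal{P}$ (as defined in the context). Consider the Det-Max optimization problem $$\max_{\mathbf{H}\in\mathbb{R}^{M\times r},\ \mathbf{S}\in\mathbb{R}^{r\times N}} \det(\mathbf{S}\mathbf{S}^T)\quad\text{subject to}\quad \mathbf{Y}=\mathbf{H}\mathbf{S},\ \ \mathbf{S}_{:,j}\in\mathcal{P}\ \ (j=1,\dots,N).$$ Then every global optimum $(\mathbf{H}_*,\mathbf{S}_* )$ of this problem satisfies $$\mathbf{H}_*=\mathbf{H}_g\boldsymbol{\Pi}^T\mathbf{D},\qquad \mathbf{S}_*=\mathbf{D}\boldsymbol{\Pi}\mathbf{S}_g,$$ for some permutation matrix $\boldsymbol{\Pi}\in\mathbb{R}^{r\times r}$ and some diagonal matrix $\mathbf{D}\in\mathbb{R}^{r\times r}$ with diagonal entries in $\{-1,+1\}$.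
   Context: $\mathbf{S}_{:,j}$ denotes the $j$-th column of $\mathbf{S}$; $\mathrm{conv}(\mathbf{S})$ is the convex hull of the columns of $\mathbf{S}$. For a convex polytope $\mathcal{P}\subset\mathbb{R}^r$ with nonempty interior, $\mathcal{E}_\mathcal{P}$ denotes its maximum volume inscribed ellipsoid (MVIE), i.e. the (unique) ellipsoid of maximal volume contained in $\mathcal{P}$, written $\mathcal{E}_\mathcal{P}=\{\mathbf{C}_\mathcal{P}\mathbf{u}+\mathbf{g}_\mathcal{P}\mid \|\mathbf{u}\|_2\le 1\}$ with $\mathbf{C}_\mathcal{P}\succeq 0$ and center $\mathbf{g}_\mathcal{P}$. For a set $C\subset\mathbb{R}^r$ and point $\mathbf{d}$, the polar of $C$ with respect to $\mathbf{d}$ is $C^{*,\mathbf{d}}=\{\mathbf{x}\in\mathbb{R}^r\mid \langle\mathbf{x},\mathbf{y}-\mathbf{d}\rangle\le 1\ \forall \mathbf{y}\in C\}$. $\mathrm{bd}(\cdot)$ denotes boundary and $\mathrm{ext}(\cdot)$ the set of extreme points (vertices). A matrix $\mathbf{S}\in\mathbb{R}^{r\times N}$ is called a sufficiently scattered factor corresponding to $\mathcal{P}$ if (i) $\mathcal{P}\supseteq\mathrm{conv}(\mathbf{S})\supset\mathcal{E}_\mathcal{P}$, and (ii) $\mathrm{conv}(\mathbf{S})^{*,\mathbf{g}_\mathcal{P}}\cap\mathrm{bd}(\mathcal{E}_\mathcal{P}^{*,\mathbf{g}_\mathcal{P}})=\mathrm{ext}(\mathcal{P}^{*,\mathbf{g}_\mathcal{P}})$.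 *)

(* Defs.v *)
From HB Require Import structures.
From mathcomp Require Import all_boot all_order all_algebra all_fingroup.
From mathcomp Require Import all_classical all_reals all_analysis.
Set Implicit Arguments. Unset Strict Implicit. Unset Printing Implicit Defensive.
Import Order.TTheory GRing.Theory Num.Theory.
Import numFieldNormedType.Exports.
Local Open Scope ring_scope.
Local Open Scope classical_set_scope.

Section Defs.
Variable R : realType.
Variable r : nat.
Notation vec := 'cV[R]_r.

Definition dotv (x y : vec) : R := \sum_(i < r) x i 0 * y i 0.

Definition norm1 (x : vec) : R := \sum_(i < r) `|x i 0|.
Definition B1 : set vec := [set x | norm1 x <= 1].

Definition unit_ball : set vec := [set u | dotv u u <= 1].

Definition psd (C : 'M[R]_r) : Prop :=
  C^T = C /\ forall x : vec, 0 <= dotv x (C *m x).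

Definition ellipsoid (C : 'M[R]_r) (g : vec) : set vec :=
  [set C *m u + g | u in unit_ball].

(* (C,g) describes the maximum volume inscribed ellipsoid of P.
   The volume of ellipsoid C g is proportional to det C for C psd. *)
Definition is_MVIE (P : set vec) (C : 'M[R]_r) (g : vec) : Prop :=
  [/\ psd C, ellipsoid C g `<=` P &
      forall C' g', psd C' -> ellipsoid C' g' `<=` P -> \det C' <= \det C].

Definition conv_cols (N : nat) (S : 'M[R]_(r, N)) : set vec :=
  [set S *m w | w in [set w : 'cV[R]_N |
     (forall j, 0 <= w j 0) /\ \sum_(j < N) w j 0 = 1]].

Definition polar (C : set vec) (d : vec) : set vec :=
  [set x | forall y, C y -> dotv x (y - d) <= 1].

Definition bd (A : set vec) : set vec := closure A `\` interior A.

Definition ext (K : set vec) : set vec :=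
  [set x | K x /\ forall y z (t : R), K y -> K z -> 0 < t < 1 ->
      x = t *: y + (1 - t) *: z -> y = x /\ z = x].

Definition suff_scattered (P : set vec) (N : nat) (S : 'M[R]_(r, N)) : Prop :=
  exists C g, [/\ is_MVIE P C g,
    conv_cols S `<=` P, ellipsoid C g `<=` conv_cols S &
    polar (conv_cols S) g `&` bd (polar (ellipsoid C g) g) = ext (polar P g)].

End Defs.

(* Main.v *)
Require Import Defs.
From HB Require Import structures.
From mathcomp Require Import all_boot all_order all_algebra all_fingroup.
From mathcomp Require Import all_classical all_reals all_analysis.
From mathcomp Require Import ring lra.
Import Order.TTheory GRing.Theory Num.Theory.
Import numFieldNormedType.Exports.
Local Open Scope ring_scope.
Local Open Scope classical_set_scope.

(** Feasibility and the full rank of [Sg] give [Ss = A *m Sg] with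
    [(\det A) ^+ 2 >= 1], and [A] maps [conv Sg], hence the maximum volume
    inscribed ellipsoid [C], into the cross-polytope.  If an affine image of the
    unit ball under [X] lies in the cross-polytope, then [|X^T s| <= 1] for every
    sign vector [s]; a suitable [s] gives [\tr (X X^T) <= 1], so by AM-GM on the
    eigenvalues [(\det X) ^+ 2 <= r ^- r], with equality only if
    [X X^T = r^-1 I].  With [X = C] this makes the ellipsoid the centred ball of
    radius [r ^- (1/2)]; with [X = A C] it makes [A] orthogonal.  Then [A^T s]
    lies in [polar (conv Sg)] and on the boundary of the polar ball, so the
    scattering condition makes it a vertex of the cube: [A^T] maps sign vectors
    to sign vectors, and an orthogonal matrix doing so is a signed permutation. *)

(** * Dot product and Euclidean norm of column vectors *)

Section DotProduct.
Context {R : realType} {r : nat}.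
Implicit Types (x y z : 'cV[R]_r) (A : 'M[R]_r) (a : R).

Lemma dotvE x y : dotv x y = (x^T *m y) 0 0.
Proof. by rewrite mxE; apply: eq_bigr => i _; rewrite mxE. Qed.

Lemma dotvC x y : dotv x y = dotv y x.
Proof. by apply: eq_bigr => i _; rewrite mulrC. Qed.

Lemma dotvDr x y z : dotv x (y + z) = dotv x y + dotv x z.
Proof. by rewrite !dotvE mulmxDr mxE. Qed.

Lemma dotvZr a x y : dotv x (a *: y) = a * dotv x y.
Proof. by rewrite !dotvE -scalemxAr mxE. Qed.

Lemma dotvZl a x y : dotv (a *: x) y = a * dotv x y.
Proof. by rewrite dotvC dotvZr dotvC. Qed.

Lemma dotvNl x y : dotv (- x) y = - dotv x y.
Proof. by rewrite -scaleN1r dotvZl mulN1r. Qed.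

Lemma dotv0 x : dotv x 0 = 0.
Proof. by rewrite dotvE mulmx0 mxE. Qed.

Lemma dotv_mulmx A x y : dotv x (A *m y) = dotv (A^T *m x) y.
Proof. by rewrite !dotvE trmx_mul trmxK mulmxA. Qed.

Lemma dotv_delta x i : dotv x (delta_mx i 0) = x i 0.
Proof.
rewrite /dotv (bigD1 i) //= mxE !eqxx mulr1 big1 ?addr0 // => j /negbTE ji.
by rewrite mxE ji mulr0.
Qed.

Lemma dotvv_ge0 x : 0 <= dotv x x.
Proof. by apply: sumr_ge0 => i _; rewrite -expr2 sqr_ge0. Qed.

Lemma dotvv_eq0 x : (dotv x x == 0) = (x == 0).
Proof.
apply/idP/eqP => [|->]; last by rewrite dotv0.
rewrite /dotv psumr_eq0 => [/allP h|i _]; last by rewrite -expr2 sqr_ge0.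
apply/colP => i; rewrite mxE; apply/eqP.
by have := h i (mem_index_enum i); rewrite /= -expr2 sqrf_eq0.
Qed.

Lemma dotvv_gt0 x : (0 < dotv x x) = (x != 0).
Proof. by rewrite lt_def dotvv_ge0 andbT dotvv_eq0. Qed.

(** On the unit ball [dotv x] is largest at [x] divided by its norm; [x = 0] is treated apart. *)
Lemma sqrt_dotv_le x (b : R) :
  (forall u, unit_ball u -> dotv x u <= b) -> Num.sqrt (dotv x x) <= b.
Proof.
move=> xb; have [->|x0] := eqVneq x 0.
  by rewrite dotv0 sqrtr0 -(dotv0 x); apply: xb; rewrite /unit_ball /= dotv0.
have n0 : 0 < Num.sqrt (dotv x x) by rewrite sqrtr_gt0 dotvv_gt0.
have nn : dotv x x = Num.sqrt (dotv x x) ^+ 2 by rewrite sqr_sqrtr ?dotvv_ge0.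
set n := Num.sqrt _ in n0 nn *.
have -> : n = dotv x (n^-1 *: x).
  by rewrite dotvZr nn; field; rewrite gt_eqF.
apply: xb; rewrite /unit_ball /= dotvZl dotvZr nn.
by rewrite le_eqVlt; apply/orP; left; apply/eqP; field; rewrite gt_eqF.
Qed.

End DotProduct.

(** * Positive definite matrices and the equality case of AM-GM *)

Section PosDef.
Context {R : realType}.

Definition posdef {n : nat} (G : 'M[R]_n) : Prop :=
  G^T = G /\ forall x : 'cV[R]_n, x != 0 -> 0 < dotv x (G *m x).

Lemma posdef_congruence {n : nat} (P : 'M[R]_n) {G : 'M[R]_n} :
  posdef G -> P \in unitmx -> posdef (P *m G *m P^T).
Proof.
case=> Gsym Gpos uP; split=> [|x x0].
  by rewrite !trmx_mul trmxK Gsym mulmxA.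
rewrite -!mulmxA dotv_mulmx; apply: Gpos.
apply: contraNneq x0 => Px0.
by rewrite -[x](mulKmx (_ : P^T \in unitmx)) ?unitmx_tr // Px0 mulmx0.
Qed.

Lemma posdef_gram {m n : nat} {X : 'M[R]_(m, n)} :
  row_free X -> posdef (X *m X^T).
Proof.
move=> fX; split=> [|x x0]; first by rewrite trmx_mul trmxK.
have -> : dotv x (X *m X^T *m x) = dotv (X^T *m x) (X^T *m x).
  by rewrite !dotvE trmx_mul trmxK !mulmxA.
rewrite dotvv_gt0; apply: contraNneq x0 => /(congr1 trmx).
rewrite trmx_mul trmxK trmx0 -(mul0mx _ X) => /(row_free_inj fX) /(congr1 trmx).
by rewrite trmxK trmx0 => ->.
Qed.

(** Strictness away from 1 is what produces the equality case of AM-GM. *)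
Lemma ltr_lnB1 {a : R} : 0 < a -> a != 1 -> ln a < a - 1.
Proof.
move=> a0 a1; have := @expR_gt1Dx R (ln a).
rewrite lnK ?posrE // => h; suff: 1 + ln a < a by lra.
by apply: h; rewrite ln_eq0.
Qed.

(** One step of symmetric Gaussian elimination: a congruence of determinant 1 clears the
    off-diagonal blocks, leaving the pivot [a] and the Schur complement [S]. *)
Lemma posdef_Schur {n : nat} (G : 'M[R]_(1 + n)) : posdef G ->
  exists (a : R) (v : 'rV[R]_n) (S : 'M[R]_n),
    [/\ 0 < a, posdef S, \det G = a * \det S &
        G = block_mx a%:M v v^T (S + a^-1 *: (v^T *m v))].
Proof.
move=> pG; have [Gsym Gpos] := pG.
pose a : R := ulsubmx G 0 0; pose v := ursubmx G; pose B := drsubmx G.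
have Gblk : G = block_mx a%:M v v^T B.
  rewrite -[LHS]submxK; congr block_mx; first exact: mx11_scalar.
  by rewrite trmx_ursub Gsym.
have Bsym : B^T = B by rewrite /B trmx_drsub Gsym.
have a0 : 0 < a.
  have := Gpos (col_mx 1 0); rewrite Gblk mul_block_col !mulmx1 !mulmx0 !addr0.
  rewrite dotvE tr_col_mx mul_row_col trmx0 mul0mx addr0 trmx1 mul1mx mxE eqxx.
  rewrite mulr1n; apply; rewrite col_mx_eq0 negb_and; apply/orP; left.
  by apply/eqP => /matrixP/(_ 0 0)/eqP; rewrite !mxE eqxx oner_eq0.
have an0 : a != 0 by rewrite gt_eqF.
pose P : 'M[R]_(1 + n) := block_mx 1%:M 0 (- a^-1 *: v^T) 1%:M.
pose S := B - a^-1 *: (v^T *m v).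
have PGP : P *m G *m P^T = block_mx a%:M 0 0 S.
  rewrite Gblk /P tr_block_mx !mulmx_block !trmx1 trmx0 linearZ /= trmxK.
  rewrite !mul1mx !mul0mx !mulmx1 !mulmx0 !addr0 -scalemxAr.
  rewrite !mul_mx_scalar !mul_scalar_mx !scalerA mulrN divff // scaleN1r.
  by rewrite mulNr mulVf // scaleN1r !addNr mul0mx add0r -scalemxAl scaleNr addrC.
have detP : \det P = 1 by rewrite det_lblock !det1 mulr1.
exists a, v, S; split=> //.
- have [] := posdef_congruence P pG; first by rewrite unitmxE detP unitr1.
  rewrite PGP => _ Spos; split=> [|x x0].
    by rewrite /S linearB linearZ /= Bsym trmx_mul trmxK.
  have := Spos (col_mx 0 x); rewrite mul_block_col !mul0mx !mulmx0 !add0r.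
  rewrite !dotvE tr_col_mx mul_row_col trmx0 mul0mx add0r; apply.
  by rewrite col_mx_eq0 negb_and x0 orbT.
- have := congr1 determinant PGP; rewrite !det_mulmx det_tr detP mulr1 mul1r.
  by rewrite det_ublock det_scalar1.
- by rewrite /S subrK.
Qed.

(* [\tr G - ln (\det G)] is the sum of [l - ln l >= 1] over the eigenvalues [l]
   of [G]; Schur complements replace the spectral decomposition. *)
Lemma posdef_tr_ln_det {n : nat} {G : 'M[R]_n} : posdef G ->
  0 < \det G /\ (\tr G - ln (\det G) <= n%:R -> G = 1%:M).
Proof.
elim: n G => [|n IH] G pG.
  by rewrite det_mx00; split=> // _; apply/matrixP => -[].
have [a [v [S [a0 pS -> Gblk]]]] := @posdef_Schur n G pG.
have [S0 S1] := IH _ pS; split; first exact: mulr_gt0.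
have -> : \tr G = a + (\tr S + a^-1 * dotv v^T v^T).
  rewrite Gblk (@mxtrace_block _ 1 n) mxtrace_scalar mulr1n mxtraceD mxtraceZ.
  by rewrite mxtrace_mulC trace_mx11 dotvE trmxK.
rewrite lnM ?posrE // -natr1 => tr_le.
have v_ge0 : 0 <= a^-1 * dotv v^T v^T.
  by rewrite mulr_ge0 ?dotvv_ge0 ?invr_ge0 ?ltW.
have a_ge0 : ln a <= a - 1.
  by have [->|a1] := eqVneq a 1; [rewrite ln1 subrr|rewrite ltW ?ltr_lnB1].
(* As [a - ln a >= 1] and the term in [v] is nonnegative, the bound passes to [S]. *)
have {}S1 : S = 1%:M by apply: S1; lra.
move: tr_le; rewrite S1 mxtrace1 det1 ln1 => tr_le.
(* What remains is [a - ln a + a^-1 * dotv v^T v^T <= 1], which forces [a = 1] and then [v = 0]. *)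
have a1 : a = 1.
  by apply/eqP; apply/negP => /negP a1; have := ltr_lnB1 a0 a1; lra.
have /eqP : dotv v^T v^T = 0.
  by apply/eqP; rewrite eq_le dotvv_ge0 andbT; move: tr_le; rewrite a1 invr1 ln1; lra.
rewrite dotvv_eq0 => /eqP/(congr1 trmx); rewrite trmxK trmx0 => v0.
by rewrite Gblk S1 v0 a1 mulmx0 scaler0 addr0 trmx0 -(@scalar_mx_block _ 1 n).
Qed.

End PosDef.

(** * Sign vectors and rigidity of Gram matrices *)

Section Signs.
Context {R : realType}.

Definition sign_vec {n : nat} (s : 'cV[R]_n) : Prop :=
  forall i, s i 0 = 1 \/ s i 0 = -1.

Lemma sign_vecN {n : nat} {s : 'cV[R]_n} : sign_vec s -> sign_vec (- s).
Proof. by move=> ss i; rewrite mxE; case: (ss i) => ->; [right|left; rewrite opprK]. Qed.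

(* The signs are chosen one at a time so that every cross term is nonnegative. *)
Lemma exists_sign_ge_trace {m n : nat} (X : 'M[R]_(m, n)) :
  exists2 s, sign_vec s & \tr (X *m X^T) <= dotv (X^T *m s) (X^T *m s).
Proof.
elim: m X => [|m IH] X.
  by exists 0 => [[]//|]; rewrite /mxtrace big_ord0 dotvv_ge0.
pose x := @usubmx R 1 m n X; pose Y := @dsubmx R 1 m n X.
have XE : X = @col_mx R 1 m n x Y by rewrite vsubmxK.
have [s' ss' Ys'] := IH Y.
have [e e1 ecross] : exists2 e : R, e = 1 \/ e = -1 &
    0 <= e * dotv x^T (Y^T *m s').
  have [h|h] := leP 0 (dotv x^T (Y^T *m s')).
    by exists 1; [left|rewrite mul1r].
  by exists (-1); [right|rewrite mulN1r oppr_ge0 ltW].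
exists (@col_mx R 1 m 1 e%:M s').
  move=> i; case: (split_ordP (i : 'I_(1 + m))) => j ->.
    by rewrite (@col_mxEu R 1 m 1) mxE [j]ord1 mulr1n.
  by rewrite (@col_mxEd R 1 m 1).
have ee : e * e = 1 by case: e1 => ->; rewrite ?mulrNN mulr1.
have -> : X^T *m @col_mx R 1 m 1 e%:M s' = e *: x^T + Y^T *m s'.
  by rewrite XE (@tr_col_mx R 1 m) (@mul_row_col R n 1 m) mul_mx_scalar.
have -> : \tr (X *m X^T) = dotv x^T x^T + \tr (Y *m Y^T).
  rewrite XE (@tr_col_mx R 1 m) (@mul_col_row R 1 m n 1 m) (@mxtrace_block _ 1 m).
  by rewrite trace_mx11 dotvE trmxK.
rewrite dotvDr ![dotv (e *: _ + _) _]dotvC !dotvDr !dotvZr !dotvZl.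
by rewrite mulrA ee mul1r (dotvC (Y^T *m s')); lra.
Qed.

(** Scaled by [n], the Gram matrix has trace at most [n], thanks to a well-chosen sign vector, and
    determinant at least 1. This is the equality case of [posdef_tr_ln_det]. *)
Lemma gram_eq_scalar {n : nat} (X : 'M[R]_n) : (0 < n)%N ->
  (forall s, sign_vec s -> dotv (X^T *m s) (X^T *m s) <= 1) ->
  n%:R ^- n <= \det X ^+ 2 -> X *m X^T = (n%:R^-1)%:M.
Proof.
move=> n0 Xs dX; have n0R : (0 : R) < n%:R by rewrite ltr0n.
have uX : X \in unitmx.
  rewrite unitmxE unitfE -sqrf_eq0 gt_eqF //; apply: lt_le_trans dX.
  by rewrite invr_gt0 exprn_gt0.
have pX : posdef (X *m X^T) by apply: posdef_gram; rewrite row_free_unit.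
have pnX : posdef (n%:R *: (X *m X^T)).
  case: pX => Xsym Xpos; split=> [|x x0]; first by rewrite linearZ /= Xsym.
  by rewrite -scalemxAl dotvZr mulr_gt0 ?Xpos.
have [_ nX1] := posdef_tr_ln_det pnX.
have {nX1} : n%:R *: (X *m X^T) = 1%:M.
  apply: nX1; rewrite mxtraceZ detZ det_mulmx det_tr -expr2.
  have [s ss Xtr] := exists_sign_ge_trace X.
  have tr1 : \tr (X *m X^T) <= 1 by exact: le_trans (Xs _ ss).
  rewrite lerBlDr -[leLHS]addr0 lerD //.
    by rewrite ger_pMr.
  by apply: ln_ge0; rewrite -ler_pdivrMl ?exprn_gt0 // mulr1.
move=> /(congr1 (fun M => n%:R^-1 *: M)).
by rewrite scalerA mulVf ?gt_eqF // scale1r scalemx1.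
Qed.

End Signs.

(** * The cross-polytope and its maximum volume inscribed ellipsoid *)

Section CrossPolytope.
Context {R : realType} {r : nat}.
Implicit Types (x s g : 'cV[R]_r) (A C : 'M[R]_r).

Definition sign_of x : 'cV[R]_r := \col_i (if 0 <= x i 0 then 1 else -1).

Lemma sign_of_vec x : sign_vec (sign_of x).
Proof. by move=> i; rewrite mxE; case: ifP; [left|right]. Qed.

Lemma dotv_sign_of x : dotv (sign_of x) x = Defs.norm1 x.
Proof.
apply: eq_bigr => i _; rewrite mxE; case: ifP => [h|/negbT].
  by rewrite mul1r ger0_norm.
by rewrite -ltNge => h; rewrite mulN1r ltr0_norm.
Qed.

Lemma dotv_le_norm1 {x} (y : 'cV[R]_r) :
  (forall i, `|x i 0| <= 1) -> dotv x y <= Defs.norm1 y.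
Proof.
move=> x1; apply: ler_sum => i _; apply: le_trans (ler_norm _) _.
by rewrite normrM ler_piMl.
Qed.

Lemma sign_vec_norm s i : sign_vec s -> `|s i 0| = 1.
Proof. by case/(_ i) => ->; rewrite ?normrN normr1. Qed.

Lemma dotv_sign {s} : sign_vec s -> dotv s s = r%:R.
Proof.
move=> ss; rewrite /dotv (eq_bigr (fun=> 1)) => [|i _].
  by rewrite sumr_const card_ord.
by case: (ss i) => ->; rewrite ?mulrNN mulr1.
Qed.

(** Sign vectors are the facet normals of the cross-polytope; the square root is the maximum of
    [dotv s (C *m u)] over the unit ball. *)
Lemma affine_ball_B1 {C g s} :
  (forall u, unit_ball u -> B1 (C *m u + g)) -> sign_vec s ->
  Num.sqrt (dotv (C^T *m s) (C^T *m s)) <= 1 - dotv s g.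
Proof.
move=> CB ss; apply: sqrt_dotv_le => u u1; rewrite -dotv_mulmx lerBrDr -dotvDr.
apply: le_trans (dotv_le_norm1 _ _) (CB u u1) => i.
by rewrite sign_vec_norm.
Qed.

(* Applying the bound to [s] and [- s] removes the contribution of [g]. *)
Lemma affine_ball_B1_dotv {C g s} :
  (forall u, unit_ball u -> B1 (C *m u + g)) -> sign_vec s ->
  dotv (C^T *m s) (C^T *m s) <= 1.
Proof.
move=> CB ss; have h1 := affine_ball_B1 CB ss.
have := affine_ball_B1 CB (sign_vecN ss).
rewrite mulmxN !dotvNl (dotvC (C^T *m s)) dotvNl !opprK => h2.
by rewrite -(@ler_sqrt _ _ 1) // sqrtr1; lra.
Qed.

(** This ball is the competitor that bounds the determinant of the MVIE from below. *)
Lemma ball_sub_B1 : (0 < r)%N ->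
  ellipsoid ((Num.sqrt r%:R)^-1)%:M 0 `<=` @B1 R r.
Proof.
move=> r0 _ [u u1 <-]; rewrite addr0 mul_scalar_mx /B1 /= /Defs.norm1.
have r0R : (0 : R) < r%:R by rewrite ltr0n.
set c := (Num.sqrt _)^-1.
have cc : c ^+ 2 = r%:R^-1 by rewrite exprVn sqr_sqrtr ?ltW.
(* AM-GM: [2 c |u i| <= u i ^ 2 + c ^ 2] *)
apply: (@le_trans _ _ (\sum_(i < r) (2^-1 * (u i 0 * u i 0) + 2^-1 * r%:R^-1))).
  apply: ler_sum => i _; rewrite mxE -cc ler_norml.
  by have := sqr_ge0 (c - u i 0); have := sqr_ge0 (c + u i 0); rewrite !expr2; lra.
rewrite big_split -mulr_sumr sumr_const card_ord /= -mulrnAr -(mulr_natr r%:R^-1).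
by rewrite mulVf ?gt_eqF //; move: u1; rewrite /unit_ball /= /dotv; lra.
Qed.

Lemma psd_scalar {c : R} : 0 <= c -> psd (c%:M : 'M[R]_r).
Proof.
move=> c0; split=> [|x]; first exact: tr_scalar_mx.
by rewrite mul_scalar_mx dotvZr mulr_ge0 // dotvv_ge0.
Qed.

Lemma dotv_conformal C x y : C *m C^T = (r%:R^-1)%:M ->
  dotv (C^T *m x) (C^T *m y) = r%:R^-1 * dotv x y.
Proof. by move=> CC; rewrite -dotv_mulmx mulmxA CC mul_scalar_mx dotvZr. Qed.

Lemma B1_MVIE {C g} : (0 < r)%N -> is_MVIE (@B1 R r) C g ->
  [/\ r%:R ^- r <= \det C ^+ 2, C *m C^T = (r%:R^-1)%:M & g = 0].
Proof.
move=> r0 [_ CB Cmax].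
have r0R : (0 : R) < r%:R by rewrite ltr0n.
have {}CB u : unit_ball u -> B1 (C *m u + g) by move=> u1; apply: CB; exists u.
have c0 : 0 <= (Num.sqrt (r%:R : R))^-1 by rewrite invr_ge0 sqrtr_ge0.
have dC : r%:R ^- r <= \det C ^+ 2.
  have := Cmax _ _ (psd_scalar c0) (ball_sub_B1 r0); rewrite det_scalar => h.
  have -> : r%:R ^- r = ((Num.sqrt (r%:R : R))^-1 ^+ r) ^+ 2.
    by rewrite -exprM mulnC exprM exprVn sqr_sqrtr ?ltW // exprVn.
  by rewrite lerXn2r // nnegrE ?exprn_ge0 // (le_trans _ h) // exprn_ge0.
have CC : C *m C^T = (r%:R^-1)%:M.
  by apply: gram_eq_scalar => // s; exact: affine_ball_B1_dotv CB.
(* For the signs of [g] the bound reads [1 <= 1 - norm1 g], so the centre vanishes. *)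
split=> //; have := affine_ball_B1 CB (sign_of_vec g).
rewrite dotv_conformal // (dotv_sign (sign_of_vec g)) mulVf ?gt_eqF // sqrtr1.
rewrite dotv_sign_of => g1; have {}g1 : Defs.norm1 g <= 0 by lra.
have : Defs.norm1 g == 0 by rewrite eq_le g1 sumr_ge0.
rewrite psumr_eq0 // => /allP g0; apply/colP => i; rewrite mxE.
by apply/eqP; rewrite -normr_eq0; exact: (g0 i (mem_index_enum i)).
Qed.

(** The polar consists of the [x] with [C^T *m x] in the unit ball, and equality puts [x] on its
    boundary. *)
Lemma bd_polar_ellipsoid C x : dotv (C^T *m x) (C^T *m x) = 1 ->
  bd (polar (ellipsoid C 0) 0) x.
Proof.
move=> x1; split.
  apply: subset_closure => _ [u u1 <-]; rewrite addr0 subr0 dotv_mulmx.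
  set w := C^T *m x in x1 *.
  (* Expanding the square gives [2 * dotv w u <= 1 + dotv u u <= 2]. *)
  have := dotvv_ge0 (w - u); rewrite dotvDr !(dotvC (w - u)) !dotvDr x1.
  rewrite -scaleN1r !dotvZl !dotvZr (dotvC u w); move: u1; rewrite /unit_ball /=.
  by lra.
move=> /= xint.
have : \forall t \near (1 : R), polar (ellipsoid C 0) 0 (t *: x).
  have cx : (fun t : R => t *: x) @ (1 : R) --> 1 *: x.
    by apply: cvgZr_tmp; exact: cvg_id.
  by apply: cx; rewrite scale1r.
move=> /nbhs_ballP [e /= e0] /(_ (1 + e / 2)) xpol.
(* An interior point could be pushed outward along its ray; the ellipsoid point where [dotv x]
   equals 1 forbids this. *)
have /xpol/(_ (C *m (C^T *m x) + 0)) : ball (1 : R) e (1 + e / 2).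
  by rewrite /ball /= opprD addrA subrr sub0r normrN gtr0_norm; lra.
rewrite addr0 subr0 dotvZl dotv_mulmx x1 mulr1 => h.
suff: 1 + e / 2 <= 1 by lra.
by apply: h; exists (C^T *m x); rewrite ?addr0 // /unit_ball /= x1.
Qed.

(** * The polar cube, its vertices and their orthogonal symmetries *)

Lemma norm1_delta i : Defs.norm1 (delta_mx i 0 : 'cV[R]_r) = 1.
Proof.
rewrite /Defs.norm1 (bigD1 i) //= mxE !eqxx normr1 big1 ?addr0 // => j /negbTE ji.
by rewrite mxE ji normr0.
Qed.

Lemma polar_B1P x : polar (@B1 R r) 0 x <-> forall i, `|x i 0| <= 1.
Proof.
split=> [xpol i|x1 y y1]; last first.
  by rewrite subr0; apply: le_trans (dotv_le_norm1 _ _) y1.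
rewrite ler_norml; apply/andP; split.
  have := xpol (- delta_mx i 0); rewrite subr0 dotvC dotvNl dotvC dotv_delta lerNl.
  apply; rewrite /B1 /= -(norm1_delta i); apply: ler_sum => j _.
  by rewrite mxE normrN.
rewrite -dotv_delta -[delta_mx _ _]subr0; apply: xpol.
by rewrite /B1 /= norm1_delta.
Qed.

(** A coordinate of absolute value below 1 can move by its slack [d] both ways, making [x] the
    midpoint of a nontrivial segment of the cube. *)
Lemma ext_polar_B1_sign x : ext (polar (@B1 R r) 0) x -> sign_vec x.
Proof.
move=> [/polar_B1P x1 xext] i; have := x1 i; rewrite le_eqVlt => /orP[/eqP xi|xi].
  move: xi; have [h|h] := leP 0 (x i 0).
    by rewrite ger0_norm // => ->; left.
  by rewrite ltr0_norm // => <-; right; rewrite opprK.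
pose d := 1 - `|x i 0|; have d0 : 0 < d by rewrite subr_gt0.
have pd (e : R) : `|e| <= 1 -> polar (@B1 R r) 0 (x + (e * d) *: delta_mx i 0).
  move=> e1; apply/polar_B1P => j; rewrite !mxE; have [->|_] := eqVneq j i.
    rewrite mulr1; apply: le_trans (ler_normD _ _) _.
    by rewrite normrM (gtr0_norm d0) -lerBrDl -/d ler_piMl // ltW.
  by rewrite mulr0 addr0.
have [] := xext _ _ 2^-1 (pd 1 _) (pd (-1) _).
- by rewrite normr1.
- by rewrite normrN normr1.
- by apply/andP; split; lra.
- apply/colP => j; rewrite !mxE; lra.
move=> /colP/(_ i); rewrite !mxE !eqxx mulr1 mul1r => h.
by move: d0; suff -> : d = 0; [rewrite ltxx|lra].
Qed.

Lemma signed_perm_of_orthogonal {A} : A *m A^T = 1%:M ->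
  (forall s, sign_vec s -> sign_vec (A^T *m s)) ->
  exists (s : 'S_r) (d : 'rV[R]_r),
    (forall i, d 0 i = 1 \/ d 0 i = -1) /\ A = diag_mx d *m perm_mx s.
Proof.
move=> AA As.
(* Flipping the sign [i] of the all-ones vector changes entry [j] of the image by [2 * A i j], and
   both images are sign vectors. *)
have A01 i j : A i j = 0 \/ (A i j = 1 \/ A i j = -1).
  have s1 : sign_vec (const_mx 1 : 'cV[R]_r) by move=> k; rewrite mxE; left.
  have s2 : sign_vec (const_mx 1 - 2 *: delta_mx i 0 : 'cV[R]_r).
    move=> k; rewrite !mxE; case: (k == i) => /=; [right|left]; lra.
  have := As _ s1 j; have := As _ s2 j.
  rewrite mulmxBr -scalemxAr -colE !mxE.
  by case=> h1 [h2|h2]; lra.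
have AAE i k : \sum_j A i j * A k j = (i == k)%:R.
  by move/matrixP/(_ i k): AA; rewrite !mxE => <-; apply: eq_bigr => j _; rewrite mxE.
have /fin_all_exists [p Ap] i : exists j, A i j != 0.
  apply/existsP; apply: contraT => /existsPn A0.
  have := AAE i i; rewrite eqxx big1 => [/eqP|j _].
    by rewrite eq_sym oner_eq0.
  by have := A0 j; rewrite negbK => /eqP ->; rewrite mulr0.
(* The entry at [p i] already exhausts the unit norm of row [i]. *)
have A0 i j : j != p i -> A i j = 0.
  move=> ji; have := AAE i i; rewrite eqxx (bigD1 (p i)) //= (bigD1 j) //=.
  set S := \sum_(_ | _) _; have S0 : 0 <= S.
    by apply: sumr_ge0 => k _; rewrite -expr2 sqr_ge0.
  have -> : A i (p i) * A i (p i) = 1.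
    case: (A01 i (p i)) => [/eqP|]; first by rewrite (negbTE (Ap i)).
    by case=> ->; rewrite ?mulrNN mulr1.
  by case: (A01 i j) => // -[] ->; rewrite ?mulrNN mulr1; lra.
(* Two distinct rows supported on the same column could not be orthogonal. *)
have pinj : injective p.
  move=> i k pik; apply/eqP; apply: contraT => /negbTE ik.
  have := AAE i k; rewrite ik (bigD1 (p i)) //= big1 => [|j jp].
    move=> /eqP; rewrite addr0 mulf_eq0 (negbTE (Ap i)) pik.
    by rewrite (negbTE (Ap k)).
  by rewrite A0 // mul0r.
exists (perm pinj), (\row_i A i (p i)); split=> [i|].
  by rewrite mxE; case: (A01 i (p i)) => // /eqP; rewrite (negbTE (Ap i)).
apply/matrixP => i j; rewrite mul_diag_mx !mxE permE.
by have [<-|ij] := eqVneq (p i) j; rewrite ?mulr1 // mulr0 A0 // eq_sym.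
Qed.

(** A row vector killing the columns of [S] kills their hull, hence every column of the invertible
    [C]. *)
Lemma row_free_of_ellipsoid {N : nat} {S : 'M[R]_(r, N)} {C} : C \in unitmx ->
  ellipsoid C 0 `<=` conv_cols S -> row_free S.
Proof.
move=> uC CS; apply: inj_row_free => v vS.
suff: v *m C = 0 by move/(congr1 (mulmx^~ (invmx C))); rewrite mulmxK // mul0mx.
apply/rowP => i; rewrite [RHS]mxE.
have [] : conv_cols S (C *m delta_mx i 0).
  apply: CS; exists (delta_mx i 0); rewrite ?addr0 // /unit_ball /=.
  by rewrite dotv_delta mxE !eqxx.
move=> w _ /(congr1 (fun x => (v *m x) 0 0)).
by rewrite !mulmxA vS mul0mx -colE !mxE => <-.
Qed.

(** The signs of [S *m w] give one linear functional that is at most 1 on every column and equals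
    the norm at [S *m w]. *)
Lemma conv_cols_B1 {N : nat} {S : 'M[R]_(r, N)} :
  (forall j, B1 (col j S)) -> conv_cols S `<=` @B1 R r.
Proof.
move=> SB _ [w [w0 w1] <-]; rewrite /B1 /= -dotv_sign_of -[leRHS]w1.
rewrite dotvE mulmxA mxE; apply: ler_sum => j _; rewrite ler_piMl //.
set s := sign_of _.
have -> : (s^T *m S) 0 j = dotv s (col j S).
  by rewrite mxE; apply: eq_bigr => i _; rewrite !mxE.
apply: le_trans (dotv_le_norm1 _ _) (SB j) => i.
by rewrite (sign_vec_norm _ _ (sign_of_vec _)).
Qed.

End CrossPolytope.

(** * Identifiability of the factors *)

Theorem theorem3 (R : realType) (r M N : nat)
  (Hg : 'M[R]_(M, r)) (Sg : 'M[R]_(r, N)) :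
  (0 < r)%N -> (r <= minn M N)%N ->
  \rank Hg = r ->
  (forall j : 'I_N, B1 (col j Sg)) ->
  suff_scattered (@B1 R r) Sg ->
  forall (Hs : 'M[R]_(M, r)) (Ss : 'M[R]_(r, N)),
    (* (Hs, Ss) is a global optimum of the Det-Max problem *)
    (Hg *m Sg = Hs *m Ss /\ (forall j : 'I_N, B1 (col j Ss))) ->
    (forall (H : 'M[R]_(M, r)) (S : 'M[R]_(r, N)),
        Hg *m Sg = H *m S -> (forall j : 'I_N, B1 (col j S)) ->
        \det (S *m S^T) <= \det (Ss *m Ss^T)) ->
    exists (s : 'S_r) (d : 'rV[R]_r),
      (forall i, d 0 i = 1 \/ d 0 i = -1) /\
      Hs = Hg *m (perm_mx s)^T *m diag_mx d /\
      Ss = diag_mx d *m perm_mx s *m Sg.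
Proof.
move=> r0 _ rkHg SgB [C [g [MVIE _ ellS ssc]]] Hs Ss [HSE SsB] opt.
have [dC CC g0] := B1_MVIE r0 MVIE; subst g.
have r0R : (0 : R) < r%:R by rewrite ltr0n.
have uC : C \in unitmx.
  rewrite unitmxE unitfE -sqrf_eq0 gt_eqF //; apply: lt_le_trans dC.
  by rewrite invr_gt0 exprn_gt0.
have fS : row_free Sg := row_free_of_ellipsoid uC ellS.
have [dS _] := posdef_tr_ln_det (posdef_gram fS).
have [L LHg] : exists L, L *m Hg = 1%:M by apply/row_fullP; rewrite /row_full rkHg.
pose B := L *m Hs; have SgE : Sg = B *m Ss.
  by rewrite -mulmxA -HSE mulmxA LHg mul1mx.
(* A singular [B] would make the positive [\det (Sg *m Sg^T)] vanish. *)
have uB : B \in unitmx.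
  rewrite unitmxE unitfE; apply: contraL dS => /eqP dB.
  by rewrite SgE trmx_mul mulmxA -(mulmxA B) !det_mulmx dB !mul0r ltxx.
pose A : 'M[R]_r := invmx B; have SsE : Ss = A *m Sg by rewrite SgE mulKmx.
(* The optimum is compared with the feasible pair [(Hg, Sg)]. *)
have dA : 1 <= \det A ^+ 2.
  have := opt Hg Sg erefl SgB.
  rewrite SsE trmx_mul mulmxA -(mulmxA A) !det_mulmx det_tr mulrAC -expr2.
  by rewrite ler_pMl.
have AB1 y : conv_cols Sg y -> B1 (A *m y).
  move=> [w w1 <-]; rewrite mulmxA -SsE; apply: (conv_cols_B1 SsB).
  by exists w.
have ACB u : unit_ball u -> B1 (A *m C *m u + 0).
  move=> u1; rewrite addr0 -mulmxA; apply/AB1/ellS; exists u => //.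
  by rewrite addr0.
have AA : A *m A^T = 1%:M.
  have : A *m C *m (A *m C)^T = (r%:R^-1)%:M.
    apply: gram_eq_scalar => // [s|]; first exact: affine_ball_B1_dotv ACB.
    by rewrite det_mulmx exprMn (le_trans dC) // ler_peMl ?sqr_ge0.
  rewrite trmx_mul mulmxA -(mulmxA A) CC mul_mx_scalar -scalemxAl.
  move=> /(congr1 (fun M => r%:R *: M)).
  by rewrite scalerA scale_scalar_mx mulfV ?gt_eqF // scale1r.
(* Polarity holds because [A] maps the hull into [B1]; the boundary condition because [A] is
   orthogonal and [dotv s s = r]. *)
have As s : sign_vec s -> sign_vec (A^T *m s).
  move=> ss; apply: ext_polar_B1_sign; rewrite -ssc; split.
    move=> y Sy; rewrite subr0 -dotv_mulmx.
    apply: le_trans (dotv_le_norm1 _ _) (AB1 y Sy) => i.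
    by rewrite sign_vec_norm.
  apply: bd_polar_ellipsoid.
  rewrite dotv_conformal // -dotv_mulmx mulmxA AA mul1mx dotv_sign //.
  by rewrite mulVf ?gt_eqF.
have [s [d [d1 AE]]] := signed_perm_of_orthogonal AA As.
exists s, d; split=> //; split; last by rewrite -AE.
(* Cancelling the full-rank [Sg] gives [Hg = Hs *m A], and [A^T] inverts [A]. *)
have -> : Hs = Hg *m A^T.
  have : Hg *m Sg = Hs *m A *m Sg by rewrite HSE SsE mulmxA.
  by move/(row_free_inj fS) ->; rewrite -mulmxA AA mulmx1.
by rewrite AE trmx_mul tr_diag_mx mulmxA.
Qed.
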